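(* Let $N\ge 3$ and let $\mathcal{H}$ be a polyadic inner pairing space with underlying set of vectors $\mathsf{V}$, underlying set of scalars $K$ and $N$-place inner pairing $\langle\langle\bullet|\ldots|\bullet\rangle\rangle:\mathsf{V}^{N}\to K$. Let $\mathcal{T}$ be the set of polyadic operators $\mathbf{T}:\mathsf{V}\to\mathsf{V}$ under consideration; assume that every $\mathbf{T}\in\mathcal{T}$ has polyadic adjoints $\mathbf{T}^{\star_{12}},\mathbf{T}^{\star_{23}},\ldots,\mathbf{T}^{\star_{N-1,N}},\mathbf{T}^{\star_{N,1}}\in\mathcal{T}$, and that the uniqueness property for operators holds. Suppose that the inner pairing has the full permutation symmetry $$\langle\langle \mathsf{v}_{1}|\mathsf{v}_{2}|\ldots|\mathsf{v}_{N}\rangle\rangle=\langle\langle \mathsf{v}_{\sigma(1)}|\mathsf{v}_{\sigma(2)}|\ldots|\mathsf{v}_{\sigma(N)}\rangle\rangle\qquad\text{for all }\mathsf{v}_1,\ldots,\mathsf{v}_N\in\mathsf{V}\text{ and all }\sigma\in S_N .$$ Then: 1. all the multistars coincide: there is a single operation $\ast$ on $\mathcal{T}$ such that $\mathbf{T}^{\star_{ij}}=\mathbf{T}^{\ast}$ for every $\mathbf{T}\in\mathcal{T}$ and every pair $(i,j)\in\{(1,2),(2,3),\ldots,(N-1,N),(N,1)\}$; 2. all the operators are self-adjoint: $\mathbf{T}=\mathbf{T}^{\ast}$ for every $\mathbf{T}\in\mathcal{T}$.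
   Context: Polyadic inner pairing space: the data are a polyadic field $\langle K\mid\sigma_{m_K},\kappa_{n_K}\rangle$ ($m_K$-ary addition $\sigma_{m_K}$, $n_K$-ary multiplication $\kappa_{n_K}$), a commutative $m_V$-ary group $\langle\mathsf{V}\mid\nu_{m_V}\rangle$, a multiaction $\rho_{k_\rho}:K^{k_\rho}\times\mathsf{V}\to\mathsf{V}$ (multiplication of a vector by $k_\rho$ scalars) distributive over $\nu_{m_V}$, and an $N$-place inner pairing $\langle\langle\bullet|\ldots|\bullet\rangle\rangle:\mathsf{V}^N\to K$ which is polyadically linear in the first argument, $$\langle\langle\rho_{k_\rho}\{\lambda_1,\ldots,\lambda_{k_\rho}|\mathsf{v}_1\}|\mathsf{v}_2|\ldots|\mathsf{v}_N\rangle\rangle=\kappa_{n_K}[\lambda_1,\ldots,\lambda_{k_\rho},\langle\langle\mathsf{v}_1|\ldots|\mathsf{v}_N\rangle\rangle],$$ and polyadically distributive on each place, e.g. on the first, $$\langle\langle\nu_{m_V}[\mathsf{u}_1,\ldots,\mathsf{u}_{m_V}]|\mathsf{v}_2|\ldots|\mathsf{v}_N\rangle\rangle=\sigma_{m_K}[\langle\langle\mathsf{u}_1|\mathsf{v}_2|\ldots|\mathsf{v}_N\rangle\rangle,\ldots,\langle\langle\mathsf{u}_{m_V}|\mathsf{v}_2|\ldots|\mathsf{v}_N\rangle\rangle].$$ The arities satisfy $n_K=k_\rho+1$, $m_V=m_K$, $n_K=N$. Polyadic operator: a map $\mathbf{T}:\mathsf{V}\to\mathsf{V}$ that commutes with $\nu_{m_V}$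 and with the multiaction $\rho_{k_\rho}$. Uniqueness property: for all operators $\mathbf{T}_1,\mathbf{T}_2$ and any place $i\in\{1,\ldots,N\}$, if $\langle\langle\mathsf{v}_1|\ldots|\mathbf{T}_1\mathsf{v}_i|\ldots|\mathsf{v}_N\rangle\rangle=\langle\langle\mathsf{v}_1|\ldots|\mathbf{T}_2\mathsf{v}_i|\ldots|\mathsf{v}_N\rangle\rangle$ for all $\mathsf{v}_1,\ldots,\mathsf{v}_N\in\mathsf{V}$, then $\mathbf{T}_1=\mathbf{T}_2$. Polyadic adjoints (multistars): the operators $\mathbf{T}^{\star_{12}},\mathbf{T}^{\star_{23}},\ldots,\mathbf{T}^{\star_{N-1,N}},\mathbf{T}^{\star_{N,1}}$ are defined by the $N$ relations, required for all $\mathsf{v}_1,\ldots,\mathsf{v}_N\in\mathsf{V}$, $$\langle\langle\mathsf{v}_1|\ldots|\mathbf{T}\mathsf{v}_i|\mathsf{v}_{i+1}|\ldots|\mathsf{v}_N\rangle\rangle=\langle\langle\mathsf{v}_1|\ldots|\mathsf{v}_i|\mathbf{T}^{\star_{i,i+1}}\mathsf{v}_{i+1}|\ldots|\mathsf{v}_N\rangle\rangle\quad(1\le i\le N-1),$$ $$\langle\langle\mathsf{v}_1|\ldots|\mathsf{v}_{N-1}|\mathbf{T}\mathsf{v}_N\rangle\rangle=\langle\langle\mathbf{T}^{\star_{N,1}}\mathsf{v}_1|\mathsf{v}_2|\ldots|\mathsf{v}_N\rangle\rangle .$$ *)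

(* Defs.v *)
From mathcomp Require Import all_boot all_fingroup.
From mathcomp Require Import classical_sets.

Set Implicit Arguments.
Unset Strict Implicit.
Unset Printing Implicit Defensive.

Local Open Scope classical_set_scope.

(* An n-ary operation on X is a map {ffun 'I_n -> X} -> X; the places
   1, ..., n are the ordinals 0, ..., n - 1. *)

(* The n-tuple x with its i-th entry replaced by y. *)
Definition fupd (X : Type) (n : nat) (x : {ffun 'I_n -> X}) (i : 'I_n) (y : X) :
    {ffun 'I_n -> X} :=
  [ffun j => if j == i then y else x j].

(* The n-tuple (l_1, ..., l_k, y), meant for n = k + 1: [insub] sends a place
   j < k to the corresponding element of 'I_k, and the last place to [None]. *)
Definition fsnoc (X : Type) (n k : nat) (l : {ffun 'I_k -> X}) (y : X) :
    {ffun 'I_n -> X} :=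
  [ffun j : 'I_n => if insub (val j) is Some j' then l j' else y].

Section NaryOperations.
Variables (X : Type) (n : nat) (op : {ffun 'I_n -> X} -> X).

(* op [w_0, ..., w_(i-1), op [w_i, ..., w_(i+n-1)], w_(i+n), ..., w_(2n-2)];
   only the first 2n - 1 terms of the sequence w are used. *)
Definition nary_nest (w : nat -> X) (i : 'I_n) : X :=
  op [ffun j : 'I_n => if j < i then w j
                       else if j == i then op [ffun l : 'I_n => w (i + l)]
                       else w (j + n.-1)].

Definition nary_associative (A : set X) : Prop :=
  forall w : nat -> X, (forall t, A (w t)) ->
  forall i j : 'I_n, nary_nest w i = nary_nest w j.

Definition nary_commutative (A : set X) : Prop :=
  forall x : {ffun 'I_n -> X}, (forall j, A (x j)) ->
  forall s : 'S_n, op [ffun j => x (s j)] = op x.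

Definition nary_closed (A : set X) : Prop :=
  forall x : {ffun 'I_n -> X}, (forall j, A (x j)) -> A (op x).

Definition nary_solvable (A : set X) : Prop :=
  forall (x : {ffun 'I_n -> X}) (b : X), (forall j, A (x j)) -> A b ->
  forall i : 'I_n, exists! y, A y /\ op (fupd x i y) = b.

Definition commutative_nary_group (A : set X) : Prop :=
  [/\ A !=set0, nary_closed A, nary_associative A, nary_commutative A
    & nary_solvable A].

Definition nary_zero (z : X) : Prop :=
  forall (x : {ffun 'I_n -> X}) (i : 'I_n), op (fupd x i z) = z.

End NaryOperations.

(* Polyadic fields need not contain a zero; if there is none, the
   multiplicative n-ary group is all of K. *)
Record polyadic_field (m n : nat) (K : Type)
    (add : {ffun 'I_m -> K} -> K) (mul : {ffun 'I_n -> K} -> K) : Prop := {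
  pf_add_arity : 2 <= m;
  pf_mul_arity : 2 <= n;
  pf_add : commutative_nary_group add setT;
  pf_mulA : nary_associative mul setT;
  pf_mulC : nary_commutative mul setT;
  pf_distr : forall (x : {ffun 'I_n -> K}) (i : 'I_n) (a : {ffun 'I_m -> K}),
    mul (fupd x i (add a)) = add [ffun j => mul (fupd x i (a j))];
  pf_mul : commutative_nary_group mul [set x | ~ nary_zero mul x]
}.

(* The arity relations m_V = m_K (= m) and n_K = N are built into the types,
   k_rho is the field [karity]. *)
Record polyadicIPSpace (m N : nat) := PolyadicIPSpace {
  scalar : Type;
  vector : Type;
  karity : nat;
  sadd : {ffun 'I_m -> scalar} -> scalar;
  smul : {ffun 'I_N -> scalar} -> scalar;
  vadd : {ffun 'I_m -> vector} -> vector;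
  maction : {ffun 'I_karity -> scalar} -> vector -> vector;
  pairing : {ffun 'I_N -> vector} -> scalar;
  karityP : N = karity.+1;
  scalar_field : polyadic_field sadd smul;
  vector_group : commutative_nary_group vadd setT;
  maction_distr : forall l u,
    maction l (vadd u) = vadd [ffun j => maction l (u j)];
  pairing_linear : forall (i : 'I_N) l v, i = 0 :> nat ->
    pairing (fupd v i (maction l (v i))) = smul (fsnoc N l (pairing v));
  pairing_distr : forall (i : 'I_N) v u,
    pairing (fupd v i (vadd u)) = sadd [ffun j => pairing (fupd v i (u j))]
}.

Section Operators.
Variables (m N : nat) (H : polyadicIPSpace m N).
Local Notation V := (vector H).

Definition polyadic_operator (T : V -> V) : Prop :=
  (forall u, T (vadd u) = vadd [ffun j => T (u j)]) /\
  (forall l v, T (maction l v) = maction l (T v)).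

Definition apply_at (T : V -> V) (i : 'I_N) (v : {ffun 'I_N -> V}) :
    {ffun 'I_N -> V} :=
  fupd v i (T (v i)).

Definition uniqueness_property (Ops : set (V -> V)) : Prop :=
  forall T1 T2, Ops T1 -> Ops T2 -> forall i : 'I_N,
    (forall v, pairing (apply_at T1 i v) = pairing (apply_at T2 i v)) ->
  T1 = T2.

(* S is the (i, i + 1)-multistar of T; [ordS] is the cyclic successor on 'I_N,
   so that the last place is paired with the first one. *)
Definition is_multistar (i : 'I_N) (T S : V -> V) : Prop :=
  forall v, pairing (apply_at T i v) = pairing (apply_at S (ordS i) v).

Definition permutation_symmetric : Prop :=
  forall (v : {ffun 'I_N -> V}) (s : 'S_N),
    pairing v = pairing [ffun i => v (s i)].

End Operators.

Arguments permutation_symmetric {m N} H.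

(* Main.v *)
Require Import Defs.
From mathcomp Require Import all_boot all_fingroup.
From mathcomp Require Import classical_sets.

(** Let [S] be a multistar of [T]. A multistar relation ties [T] at one place to
    [S] at the next one; since the symmetric group is 2-transitive, permuting the
    arguments of a symmetric pairing moves these two places anywhere, so that [T]
    at place [a] and [S] at place [b] give the same value whenever [a <> b]
    ([multistar_any_places]). For three distinct places this yields the chain
    [T] at [a] = [S] at [b] = [T] at [c] = [S] at [a],
    hence [T = S] by the uniqueness property ([multistar_eq]): the third place is
    what separates the polyadic case from that of an ordinary symmetric bilinear
    form, where adjoints need not be trivial. So every multistar fixes every
    operator, and the common operation is the identity. *)

Section Places.
Set Implicit Arguments.
Unset Strict Implicit.

Lemma perm_two_transitive (I : finType) (a b c d : I) : a != b -> c != d ->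
  exists s : {perm I}, s a = c /\ s b = d.
Proof.
move=> ab cd.
(* The first transposition sends a to c and b to some b' <> c; the second one
   sends b' to d and leaves c alone, since c is neither b' nor d. *)
exists (tperm a c * tperm (tperm a c b) d)%g; rewrite !permM tpermL; split.
  rewrite tpermD 1?eq_sym //.
  by rewrite -{1}(tpermL a c) (inj_eq perm_inj).
by rewrite tpermL.
Qed.

Lemma ordS_neq (n : nat) (i : 'I_n) : 1 < n -> i != ordS i.
Proof.
move=> n_gt1; rewrite -val_eqE /=.
have [lt_in|le_ni] := ltnP i.+1 n; first by rewrite modn_small // neq_ltn ltnSn.
have in1 : i.+1 = n by apply/eqP; rewrite eqn_leq ltn_ord.
by rewrite in1 modnn -lt0n -ltnS in1.
Qed.

Lemma two_other_places (n : nat) (a : 'I_n) : 2 < n ->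
  exists b c : 'I_n, [/\ a != b, b != c & a != c].
Proof.
move=> n_gt2; have n_gt1 := ltnW n_gt2.
have : 0 < #|~: [set a; ordS a]|.
  by rewrite cardsCs finset.setCK card_ord cards2 ordS_neq // subn_gt0.
case/card_gt0P => c; rewrite !inE negb_or => /andP[ca cb].
by exists (ordS a), c; rewrite ordS_neq // eq_sym cb eq_sym ca.
Qed.

End Places.

Section SymmetricPairing.
Set Implicit Arguments.
Unset Strict Implicit.
Variables (m N : nat) (H : polyadicIPSpace m N).
Hypothesis sym : permutation_symmetric H.
Implicit Types T S : vector H -> vector H.

Lemma pairing_apply_at_perm T (s : 'S_N) (a : 'I_N) (v : {ffun 'I_N -> vector H}) :
  pairing (apply_at T (s a) v) = pairing (apply_at T a [ffun k => v (s k)]).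
Proof.
rewrite (sym _ s); congr pairing; apply/ffunP => k.
by rewrite !ffunE (inj_eq perm_inj).
Qed.

(** A permutation carrying [a] to [i] and [b] to [ordS i] turns the defining
    relation of the multistar into the one between the places [a] and [b]. *)
Lemma multistar_any_places (i a b : 'I_N) T S v : 1 < N ->
  is_multistar i T S -> a != b ->
  pairing (apply_at T a v) = pairing (apply_at S b v).
Proof.
move=> N_gt1 TS ab.
have [s [sa sb]] := perm_two_transitive ab (ordS_neq i N_gt1).
have [w ->] : exists w : {ffun 'I_N -> vector H}, v = [ffun k => w (s k)].
  by exists [ffun k => v ((s^-1)%g k)]; apply/ffunP => k; rewrite !ffunE permK.
by rewrite -!(pairing_apply_at_perm _ s) sa sb TS.
Qed.

(** The detour through two auxiliary places brings [S] back to the place where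
    [T] acts. *)
Lemma multistar_eq (Ops : set (vector H -> vector H)) (i : 'I_N) T S : 2 < N ->
  uniqueness_property Ops -> Ops T -> Ops S -> is_multistar i T S -> S = T.
Proof.
move=> N_gt2 uniq_op OT OS TS.
have TSab a b v := @multistar_any_places i a b T S v (ltnW N_gt2) TS.
have [b [c [ib bc ic]]] := two_other_places i N_gt2.
apply/esym/(uniq_op _ _ OT OS i) => v.
by rewrite (TSab i b) // -(TSab c b) 1?eq_sym // (TSab c i) // eq_sym.
Qed.

End SymmetricPairing.

Theorem theorem5p7 (m N : nat) (hN : 3 <= N) (H : polyadicIPSpace m N)
    (Ops : set (vector H -> vector H))
    (star : 'I_N -> (vector H -> vector H) -> (vector H -> vector H))
    (Ops_operator : forall T, Ops T -> polyadic_operator T)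
    (Ops_star : forall i T, Ops T -> Ops (star i T))
    (starP : forall i T, Ops T -> is_multistar i T (star i T))
    (uniq_op : uniqueness_property Ops)
    (sym : permutation_symmetric H) :
  exists ast : (vector H -> vector H) -> (vector H -> vector H),
    (forall T, Ops T -> Ops (ast T)) /\
    (forall i T, Ops T -> star i T = ast T) /\
    (forall T, Ops T -> T = ast T).
Proof.
exists id; split=> //; split=> // i T OT.
exact: (multistar_eq sym hN uniq_op OT (Ops_star i T OT) (starP i T OT)).
Qed.
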